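(* Let $d\ge2$ and $q_1,\dots,q_d\ge 2$ be integers. The graph $\mathrm{DL}(q_1,\dots,q_d)$ is amenable if and only if all $q_i$ coincide.
   Context: For an integer $q\ge 2$, $\mathbb T_q$ is the homogeneous tree in which every vertex has $q+1$ neighbours, with graph metric $d(\cdot,\cdot)$, a fixed origin $o$ and a fixed end $\omega$ (an end is a class of one-sided infinite geodesic rays, two rays being equivalent if their symmetric difference is finite). Let $x\curlywedge y$ be the maximal common ancestor of $x,y$, i.e. the first common vertex of the geodesic rays from $x$ and from $y$ that represent $\omega$. The Busemann function is $\mathfrak h(x)=d(x,x\curlywedge o)-d(o,x\curlywedge o)$. With $T_j=\mathbb T_{q_j}$, the Diestel-Leader graph $\mathrm{DL}(q_1,\dots,q_d)$ has vertex set $\{x_1\cdots x_d\in T_1\times\dots\times T_d:\ \mathfrak h(x_1)+\dots+\mathfrak h(x_d)=0\}$, and $x_1\cdots x_d$, $y_1\cdots y_d$ are neighbours iff there are $i\ne j$ such that $x_i\sim y_i$ in $T_i$, $x_j\sim y_j$ in $T_j$, and $x_k=y_k$ for all $k\ne i,j$. A locally finite graph $X$ is amenable if its isoperimetric constant $\kappa=\inf\{|\partial F|/\mathrm{Vol}(F): F\subset X\text{ finite (nonempty)}\}$ equals $0$, where $\partial F$ is the set of edges between $F$ and $X\setminus F$ and $\mathrm{Vol}(F)=\sum_{x\in F}\deg(x)$. *)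

(* Defs.v *)
From HB Require Import structures.
From mathcomp Require Import all_boot all_order all_algebra finmap.
From mathcomp Require Import boolp classical_sets functions cardinality reals.

Set Implicit Arguments.
Unset Strict Implicit.
Unset Printing Implicit Defensive.

Import Order.TTheory GRing.Theory Num.Theory.

Local Open Scope classical_set_scope.
Local Open Scope ring_scope.

(** * Locally finite simple graphs *)

Record lfgraph := LFGraph {
  vertex :> choiceType;
  adj : rel vertex;
  adj_sym : symmetric adj;
  adj_irr : irreflexive adj;
  adj_fin : forall x, finite_set [set y | adj x y] }.

(* By [adj_fin] the default value [fset0] of [fset_set] on infinite sets is
   never used here. *)
Definition deg (X : lfgraph) (x : X) : nat := #|` fset_set [set y | adj x y]|.

Definition vol (X : lfgraph) (F : {fset X}) : nat := (\sum_(x <- F) deg x)%N.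

(* An edge between [F] and its complement has exactly one endpoint in [F], so
   it is represented by the ordered pair (endpoint in [F], other endpoint);
   this set of pairs is finite since [X] is locally finite. *)
Definition edge_boundary (X : lfgraph) (F : {fset X}) : set (X * X) :=
  [set e | [/\ e.1 \in F, e.2 \notin F & adj e.1 e.2]].

Definition isoperimetric_constant (R : realType) (X : lfgraph) : R :=
  inf [set (#|` fset_set (edge_boundary F)|)%:R / (vol F)%:R
      | F in [set F : {fset X} | F != fset0]].

Definition amenable (R : realType) (X : lfgraph) : Prop :=
  isoperimetric_constant R X = 0.

(** * Paths, trees and the graph metric *)

Definition walk (X : lfgraph) (x y : X) (n : nat) : Prop :=
  exists p : seq X, [/\ path (@adj X) x p, last x p = y & size p = n].

Definition connected_graph (X : lfgraph) : Prop :=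
  forall x y : X, exists n, walk x y n.

(* The lower bound on the size excludes the closed walks along one edge. *)
Definition acyclic_graph (X : lfgraph) : Prop :=
  forall c : seq X, (2 < size c)%N -> ~ ucycle (@adj X) c.

(* The length of a shortest path; the default value 0 is only taken when [x]
   and [y] lie in different components. *)
Definition dist (X : lfgraph) (x y : X) : nat :=
  xget 0%N [set n | walk x y n /\ forall m, walk x y m -> (n <= m)%N].

(* These conditions determine [T] up to isomorphism, and every [q >= 1] admits
   such a [T]. *)
Definition homogeneous_tree (q : nat) (T : lfgraph) : Prop :=
  [/\ inhabited T, connected_graph T, acyclic_graph T
    & forall x : T, deg x = q.+1].

(** * Ends and the Busemann function *)

Section Ends.
Variable T : lfgraph.

Definition geodesic_ray (r : nat -> T) : Prop :=
  forall m n : nat, (m <= n)%N -> dist (r m) (r n) = (n - m)%N.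

Definition ray_equiv (r s : nat -> T) : Prop :=
  finite_set ((range r `\` range s) `|` (range s `\` range r)).

Definition is_end (w : set (nat -> T)) : Prop :=
  exists2 r, geodesic_ray r
    & w = [set s | geodesic_ray s /\ ray_equiv r s].

Definition is_confluent (w : set (nat -> T)) (x y c : T) : Prop :=
  exists r s : nat -> T,
    [/\ w r, r 0%N = x, w s, s 0%N = y
      & exists m n : nat, [/\ r m = c, s n = c
          & forall k l : nat, r k = s l -> (m <= k)%N /\ (n <= l)%N]].

(* In a tree with an end [w] the confluent exists and is unique, so the default
   value [x] is irrelevant. *)
Definition confluent (w : set (nat -> T)) (x y : T) : T :=
  xget x [set c | is_confluent w x y c].

Definition busemann (w : set (nat -> T)) (o x : T) : int :=
  (dist x (confluent w x o))%:Z - (dist o (confluent w x o))%:Z.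

End Ends.

(** * Diestel-Leader graphs *)

Section DiestelLeader.
Variables (d : nat) (T : 'I_d -> lfgraph).
Variables (o : forall i, T i) (w : forall i, set (nat -> T i)).
Arguments w : clear implicits.

Definition DL_vertex : Type :=
  {x : forall i, T i | \sum_(i < d) busemann (w i) (o i) (x i) == 0}.

Definition DL_adj : rel DL_vertex := fun x y =>
  [exists i, exists j,
    [&& i != j, adj (val x i) (val y i), adj (val x j) (val y j)
      & [forall k, (k != i) && (k != j) ==> (val x k == val y k)]]].

Lemma DL_adj_sym : symmetric DL_adj.
Proof.
move=> x y; rewrite /DL_adj; apply: eq_existsb => i; apply: eq_existsb => j.
rewrite ![adj (val y _) _]adj_sym; do 3!congr andb.
by apply: eq_forallb => k; rewrite [val y k == _]eq_sym.
Qed.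

Lemma DL_adj_irr : irreflexive DL_adj.
Proof.
move=> x; rewrite /DL_adj; apply/negbTE/negP => /existsP[i] /existsP[j /and4P[_]].
by rewrite adj_irr.
Qed.

Lemma DL_adj_fin (x : DL_vertex) : finite_set [set y | DL_adj x y].
Proof.
pose A i : {fset T i} := (val x i |` fset_set [set z | adj (val x i) z])%fset.
pose g (f : {dffun forall i, A i}) : forall i, T i := fun i => val (f i).
apply: (@sub_finite_set _ _ (val @^-1` range g)); last first.
  apply: finite_preimage; last exact/finite_image/finite_finset.
  by move=> ? ? _ _; exact: val_inj.
move=> y /=; rewrite /DL_adj => /existsP[i] /existsP[j /and4P[_ xyi xyj /forallP xyk]].
have yA k : val y k \in A k.
  rewrite in_fset1U in_fset_set; last exact: adj_fin.
  have [->|ki] := eqVneq k i; first by rewrite mem_set ?orbT.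
  have [->|kj] := eqVneq k j; first by rewrite mem_set ?orbT.
  by have := xyk k; rewrite ki kj /= eq_sym => ->.
exists [ffun k => [` yA k]%fset] => //.
by apply: functional_extensionality_dep => k; rewrite /g ffunE.
Qed.

Definition DL : lfgraph := LFGraph DL_adj_sym DL_adj_irr DL_adj_fin.

End DiestelLeader.

(* Main.v *)
Require Import Defs.
From HB Require Import structures.
From mathcomp Require Import all_boot all_order all_algebra finmap.
From mathcomp Require Import boolp classical_sets functions cardinality reals.
From mathcomp Require Import zify.

Set Implicit Arguments.
Unset Strict Implicit.
Unset Printing Implicit Defensive.

Import Order.TTheory GRing.Theory Num.Theory.

Local Open Scope classical_set_scope.
Local Open Scope ring_scope.

(** An end of a regular tree orients it: every vertex [x] has exactly one
    neighbour closer to the end, its parent, and [q] children, and the Busemann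
    function drops by one from a vertex to its parent
    ([homogeneous_tree_horocyclic]).

    Since the levels add up to zero, an edge of the Diestel-Leader graph moves
    one coordinate [i] to a child and another coordinate [j] to its parent.
    Call this an arrow of type [(i, j)].  A vertex emits [q i] arrows of type
    [(i, j)] and receives [q j] of them, for an arrow of type [(i, j)] read
    backwards is one of type [(j, i)] ([card_outs], [arrowC]).

    If [q j < q i], this imbalance is an outward flow: the arrows of type
    [(i, j)] leaving the vertices of a finite set [F] number [q i * #|F|], at
    most [q j * #|F|] of them end in [F], and the others are distinct boundary
    edges ([edge_boundary_arrow]).  As degrees are bounded, the isoperimetric
    constant is positive.

    If all [q i] are equal, consider the tetrahedron of the vertices all of
    whose coordinates descend from the ancestor at distance [m] from the
    origin.  Its depths are nonnegative with sum [d * m], and a vertex can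
    leave it only if one of its depths vanishes ([tetrahedron_boundary]).  Such
    vertices are rare: following arrows backwards, the vertices of the face
    [depth j = 0] with [depth i >= s] are at most as many as the vertices with
    [depth j = s], because arrows are now balanced ([slice_shift]); and on the
    face some [depth i] is at least [m].  Hence each of the [m + 1] disjoint
    slices [depth j = 0, ..., m] has at least a [d]-th of the size of the face
    ([bottom_slice]), and the boundary is negligible as [m] grows. *)

(** * The graph metric *)

Section Distance.
Variable X : lfgraph.
Hypothesis connX : connected_graph X.
Implicit Types x y z : X.

Lemma dist_spec x y :
  walk x y (dist x y) /\ forall n, walk x y n -> (dist x y <= n)%N.
Proof.
pose P n := walk x y n /\ forall m, walk x y m -> (n <= m)%N.
suff : exists n, P n by exact: (@xgetPex _ 0%N [set n | P n]).
have exb : exists n, `[< walk x y n >].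
  by have [n wn] := connX x y; exists n; apply/asboolP.
case: (ex_minnP exb) => n /asboolP wn nmin.
by exists n; split => // m wm; apply: nmin; apply/asboolP.
Qed.

Lemma dist_walk x y : walk x y (dist x y).
Proof. by case: (dist_spec x y). Qed.

Lemma dist_le x y n : walk x y n -> (dist x y <= n)%N.
Proof. by case: (dist_spec x y) => _; apply. Qed.

Lemma walk_cat x y z m n : walk x y m -> walk y z n -> walk x z (m + n).
Proof.
move=> [p [pp lp <-]] [p' [pp' lp' <-]]; exists (p ++ p').
by rewrite cat_path last_cat size_cat lp pp pp'.
Qed.

Lemma walk_sym x y n : walk x y n -> walk y x n.
Proof.
move=> [p [pp <- <-]]; exists (rev (belast x p)).
rewrite size_rev size_belast; split => //.
  by rewrite rev_path; under eq_path do rewrite adj_sym.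
by case: p {pp} => //= a p; rewrite rev_cons last_rcons.
Qed.

Lemma walk_adj x y : adj x y -> walk x y 1.
Proof. by move=> xy; exists [:: y]; rewrite /= xy. Qed.

Lemma dist_sym x y : dist x y = dist y x.
Proof.
by apply/eqP; rewrite eqn_leq !dist_le//; apply/walk_sym/dist_walk.
Qed.

Lemma dist_triangle y x z : (dist x z <= dist x y + dist y z)%N.
Proof. by apply: dist_le; apply: (walk_cat (dist_walk _ _) (dist_walk _ _)). Qed.

Lemma dist0_eq x y : dist x y = 0%N -> x = y.
Proof. by have [p [_ <- <-]] := dist_walk x y; case: p. Qed.

Lemma dist_xx x : dist x x = 0%N.
Proof. by apply/eqP; rewrite -leqn0; apply: dist_le; exists [::]. Qed.

Lemma dist1_adj x y : dist x y = 1%N -> adj x y.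
Proof.
have [p [+ <- <-]] := dist_walk x y.
by case: p => [//|a [|//]] /=; rewrite andbT.
Qed.

Lemma dist_adj_le x y z : adj x y -> (dist x z <= (dist y z).+1)%N.
Proof.
move=> /walk_adj/dist_le xy; apply: leq_trans (dist_triangle y _ _) _.
by rewrite -add1n leq_add2r.
Qed.

Lemma nearer_neighbour x z : x != z ->
  exists2 y, adj x y & dist x z = (dist y z).+1.
Proof.
move=> xz; have [p [pp lp sp]] := dist_walk x z.
case: p pp lp sp => [_ /= xz' _|y p /= /andP[xy yp] lp sp].
  by rewrite xz' eqxx in xz.
exists y => //; apply/eqP; rewrite eqn_leq dist_adj_le //=.
by rewrite -sp ltnS; apply: dist_le; exists p.
Qed.

Lemma geodesic_path y z : exists p, [/\ path (@adj X) y p, last y p = z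
  & forall v, v \in p -> (dist v z < dist y z)%N].
Proof.
elim: (dist y z) {-2}y (leqnn (dist y z)) => [|n IH] {}y.
  by rewrite leqn0 => /eqP/dist0_eq->; exists [::].
have [->|yz] := eqVneq y z; first by exists [::].
have [a ya daz] := nearer_neighbour yz.
rewrite daz ltnS => /IH[p [pp lp sp]].
exists (a :: p); split => //=; first by rewrite ya.
move=> v; rewrite in_cons => /orP[/eqP->//|/sp h]; exact: ltnW.
Qed.

End Distance.

(** * Distances in a tree *)

Section Tree.
Variable T : lfgraph.
Hypotheses (connT : connected_graph T) (acycT : acyclic_graph T).
Implicit Types x y z : T.

(** Removing [x] from a tree separates its neighbours: a path between two of
    them avoiding [x], once made simple, would close up to a cycle. *)
Lemma no_detour x a p : adj x a -> adj x (last a p) -> path (@adj T) a p ->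
  x \notin a :: p -> last a p = a.
Proof.
move=> xa xl pp xp; apply/eqP/negP => /negP la.
case/shortenP: pp xl la => p' pp' up' sp' xl la.
apply: (acycT (c := x :: a :: p')).
  by case: p' la {pp' up' sp' xl} => //=; rewrite eqxx.
apply/andP; split.
  by rewrite /= rcons_path xa pp' /= adj_sym.
rewrite cons_uniq up' andbT; apply: contra xp.
by rewrite !in_cons => /orP[->//|/sp' ->]; rewrite orbT.
Qed.

(** Concatenating geodesics from [y] and from [y'] to [z] gives a path that
    avoids [x], since all its vertices other than [y] and [y'] are strictly
    nearer to [z] than [x] is. *)
Lemma nearer_unique x y y' z : adj x y -> adj x y' ->
  (dist y z <= dist x z)%N -> (dist y' z <= dist x z)%N -> y = y'.
Proof.
move=> xy xy' yz y'z.
have [p [pp lp sp]] := geodesic_path connT y z.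
have [p' [pp' lp' sp']] := geodesic_path connT y' z.
have avoid u s : adj x u -> (dist u z <= dist x z)%N ->
  (forall v, v \in s -> (dist v z < dist u z)%N) -> x \notin u :: s.
  move=> xu uz su; rewrite in_cons negb_or; apply/andP; split.
    by apply: contraTneq xu => ->; rewrite adj_irr.
  by apply/negP => /su; rewrite ltnNge uz.
pose s := p ++ rev (belast y' p').
have ls : last y s = y'.
  rewrite last_cat lp -lp'; case: (p') => //= b r.
  by rewrite rev_cons last_rcons.
rewrite -ls; apply/esym/(@no_detour x); rewrite ?ls //.
- by rewrite cat_path pp lp -lp' rev_path; under eq_path do rewrite adj_sym.
- have := avoid _ _ xy yz sp; rewrite !in_cons mem_cat !negb_or => /andP[-> ->] /=.
  rewrite mem_rev; apply/negP => /mem_belast.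
  by apply/negP; exact: avoid sp'.
Qed.

(** Trees are bipartite: if [x] and [y] were equidistant from [z], the
    neighbour of [x] nearer to [z] and [y] would contradict [nearer_unique]. *)
Lemma dist_adj x y z : adj x y ->
  dist x z = (dist y z).+1 \/ dist y z = (dist x z).+1.
Proof.
move=> xy; have := dist_adj_le connT z xy.
have : (dist y z <= (dist x z).+1)%N by rewrite dist_adj_le // adj_sym.
rewrite leq_eqVlt ltnS => /orP[/eqP|yx]; first by right.
rewrite leq_eqVlt ltnS => /orP[/eqP|xy']; first by left.
have eq_d : dist x z = dist y z by apply/eqP; rewrite eqn_leq yx xy'.
have xz : x != z.
  apply: contraTneq xy => xz; move: eq_d; rewrite xz (dist_xx connT).
  by move=> /esym/(dist0_eq connT) ->; rewrite adj_irr.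
have [a xa daz] := nearer_neighbour connT xz.
have ay : a = y by apply: (nearer_unique xa xy _ yx); rewrite daz.
by move: daz; rewrite ay eq_d => /n_Sn.
Qed.

(** * The orientation towards an end *)

Section Ray.
Variable r : nat -> T.
Hypothesis rayr : geodesic_ray r.

(** The sequence [dist x (r n) - n] is nonincreasing, as [r n] and [r n.+1] are
    neighbours, and bounded below, as [r n] is at distance [n] from [r 0]; so it
    is eventually constant. *)
Lemma horofunction_exists x :
  exists v : int, exists N, forall n, (N <= n)%N -> (dist x (r n))%:Z = n%:Z + v.
Proof.
(* Shifting by [dist x (r 0)] keeps the sequence in the natural numbers. *)
pose g n := (dist x (r n) + dist x (r 0) - n)%N.
have gK n : (dist x (r n) + dist x (r 0) = n + g n)%N.
  rewrite subnKC //; have := rayr (leq0n n); rewrite subn0 => {1}<-.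
  by rewrite addnC (dist_sym connT x (r 0)) dist_triangle.
have gS n : (g n.+1 <= g n)%N.
  have := gK n; have := gK n.+1; have := dist_triangle connT (r n) x (r n.+1).
  by have := rayr (leqnSn n); rewrite subSnn; lia.
have gmono m n : (m <= n)%N -> (g n <= g m)%N.
  move=> /subnK <-; elim: (n - m)%N => // k; exact: leq_trans (gS _).
have ex : exists v, `[< exists n, g n = v >] by exists (g 0); apply/asboolP; exists 0.
case: (ex_minnP ex) => v /asboolP[N gN] vmin.
exists (v%:Z - (dist x (r 0))%:Z), N => n /gmono; rewrite gN => gnv.
have : (v <= g n)%N by apply: vmin; apply/asboolP; exists n.
have := gK n; lia.
Qed.

Definition height x : int := sval (cid (horofunction_exists x)).

Lemma heightP x :
  exists N, forall n, (N <= n)%N -> (dist x (r n))%:Z = n%:Z + height x.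
Proof. by rewrite /height; case: cid. Qed.

Lemma heightP2 x y : exists N, forall n, (N <= n)%N ->
  (dist x (r n))%:Z = n%:Z + height x /\ (dist y (r n))%:Z = n%:Z + height y.
Proof.
have [M hM] := heightP x; have [N hN] := heightP y.
by exists (M + N)%N => n MNn; split; [apply: hM|apply: hN]; lia.
Qed.

Lemma height_lip x y : height x - height y <= (dist x y)%:Z.
Proof.
have [N /(_ N (leqnn N))[hx hy]] := heightP2 x y.
have := dist_triangle connT y x (r N); lia.
Qed.

Lemma height_adj x y : adj x y ->
  height y = height x - 1 \/ height y = height x + 1.
Proof.
move=> xy; have [N /(_ N (leqnn N))[hx hy]] := heightP2 x y.
by have := dist_adj (r N) xy; lia.
Qed.

Lemma height_ray n : height (r n) = - n%:Z.
Proof.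
have [N hN] := heightP (r n).
have := hN _ (leq_addr n N); rewrite rayr ?leq_addl //; lia.
Qed.

(** The candidate is the neighbour [y] of [x] nearer to a far point of the ray.
    It remains nearer to all later points: moving along the ray, the distance
    from [x] grows by one each time and the distance from [y] cannot catch up
    without jumping by more than one. *)
Lemma parent_exists x : exists y, adj x y /\ height y = height x - 1.
Proof.
have [N hN] := heightP x.
have xN : x != r N.+1.
  apply/eqP => xr; have := hN N.+1 (leqnSn N); have := hN N (leqnn N).
  by rewrite xr (dist_xx connT); lia.
have [y xy dxy] := nearer_neighbour connT xN; exists y; split => //.
have near k : dist x (r (N.+1 + k)) = (dist y (r (N.+1 + k))).+1.
  elim: k => [|k IH]; first by rewrite addn0.
  have := hN (N.+1 + k)%N ltac:(lia); have := hN (N.+1 + k.+1)%N ltac:(lia).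
  have := dist_triangle connT (r (N.+1 + k)%N) y (r (N.+1 + k.+1)%N).
  rewrite (@rayr (N.+1 + k) (N.+1 + k.+1)); last lia.
  have := dist_adj (r (N.+1 + k.+1)) xy; lia.
have [M hM] := heightP y.
have := near M; have := hM (N.+1 + M)%N ltac:(lia).
have := hN (N.+1 + M)%N ltac:(lia); lia.
Qed.

Definition parent x : T := sval (cid (parent_exists x)).

Lemma adj_parent x : adj x (parent x).
Proof. by rewrite /parent; case: cid => y []. Qed.

Lemma height_parent x : height (parent x) = height x - 1.
Proof. by rewrite /parent; case: cid => y []. Qed.

Lemma parent_unique x y : adj x y -> height y = height x - 1 -> y = parent x.
Proof.
move=> xy hy; have [N hN] := heightP2 x y.
have [M hM] := heightP (parent x).
have [hx {}hy'] := hN (N + M)%N (leq_addr _ _).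
have hp := hM (N + M)%N (leq_addl _ _).
have hpx := height_parent x.
by apply: (@nearer_unique x _ _ (r (N + M)) xy (adj_parent x)); lia.
Qed.

Lemma adjE x y : adj x y = (y == parent x) || (x == parent y).
Proof.
apply/idP/orP => [xy|[/eqP->|/eqP->]]; rewrite ?adj_parent //.
  have [h|h] := height_adj xy; first by left; apply/eqP/parent_unique.
  by right; apply/eqP/parent_unique; rewrite 1?adj_sym // h addrK.
by rewrite adj_sym adj_parent.
Qed.

Lemma height_iter_parent k x : height (iter k parent x) = height x - k%:Z.
Proof. by elim: k => [|k IH] /=; rewrite ?height_parent ?IH; lia. Qed.

Lemma parent_ray n : parent (r n) = r n.+1.
Proof.
apply/esym/parent_unique; last by rewrite !height_ray; lia.
by apply: (dist1_adj connT); rewrite rayr // subSnn.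
Qed.

Lemma iter_parent_ray k n : iter k parent (r n) = r (k + n).
Proof. by elim: k => //= k ->; rewrite parent_ray. Qed.

(** Each step of a geodesic lowers [height] by at most one; when the total drop
    is the length, every step goes to the parent. *)
Lemma iter_parent_dist x z : (dist x z)%:Z = height x - height z ->
  iter (dist x z) parent x = z.
Proof.
move: {2}(dist x z) (erefl (dist x z)) => n; elim: n x => [|n IH] x dn.
  by rewrite dn => _; exact: dist0_eq dn.
have xz : x != z by apply: contra_eq_neq dn => ->; rewrite (dist_xx connT).
have [y xy dxy] := nearer_neighbour connT xz; rewrite dxy iterSr => hxz.
have hyz := height_lip y z.
have yx : y = parent x by apply: parent_unique => //; have := height_adj xy; lia.
by rewrite -yx IH //; have := height_adj xy; lia.
Qed.

(** Far along the ray, the distance from [x] to [r n] is the difference of their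
    heights, so the line of ancestors of [x] passes through [r n]. *)
Lemma iter_parent_meets x : exists k n, iter k parent x = r n.
Proof.
have [N hN] := heightP x.
exists (dist x (r N)), N; apply: iter_parent_dist.
by rewrite hN // height_ray; lia.
Qed.

Lemma dist_iter_parent k x : dist x (iter k parent x) = k.
Proof.
apply/eqP; rewrite eqn_leq; apply/andP; split.
  elim: k => [|k IH]; first by rewrite (dist_xx connT).
  apply: (leq_trans (dist_triangle connT (iter k parent x) _ _)).
  rewrite -addn1 leq_add //; rewrite addn1.
  exact/(dist_le connT)/walk_adj/adj_parent.
have := height_lip x (iter k parent x); rewrite height_iter_parent; lia.
Qed.

Lemma geodesic_iter_parent x : geodesic_ray (fun k => iter k parent x).
Proof. by move=> m n mn; rewrite -{1}(subnK mn) iterD dist_iter_parent. Qed.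

Lemma ray_equiv_iter_parent x : ray_equiv r (fun k => iter k parent x).
Proof.
have [k [n kn]] := iter_parent_meets x.
have join j : iter (j + k) parent x = r (j + n) by rewrite iterD kn iter_parent_ray.
rewrite /ray_equiv finite_setU; split.
  apply: (sub_finite_set (B := r @` `I_n)); last exact/finite_image/finite_II.
  move=> _ [[l _ <-] nr]; exists l => //=; rewrite ltnNge; apply/negP => nl.
  by apply: nr; exists (l - n + k)%N => //; rewrite join subnK.
apply: (sub_finite_set (B := (fun l => iter l parent x) @` `I_k)).
  move=> _ [[l _ <-] nr]; exists l => //=; rewrite ltnNge; apply/negP => kl.
  by apply: nr; exists (l - k + n)%N => //; rewrite -join subnK.
exact/finite_image/finite_II.
Qed.

(** From some time [K] on, the ray [s] runs on [r]; being geodesic, it then runs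
    forward along [r] at unit speed after finitely many steps.  The far points of
    [r] that define the height of [s k] can thus be taken on [s], where the
    distances from [s k] are known. *)
Lemma height_equiv_ray s k : geodesic_ray s -> ray_equiv r s ->
  height (s k) = height (s 0) - k%:Z.
Proof.
move=> rays; rewrite /ray_equiv finite_setU => -[_ fin_sr].
have [K sK] : exists K, forall n, (K <= n)%N -> exists l, s n = r l.
  have inj_s : injective s.
    move=> m n smn; have := rays m n; have := rays n m.
    rewrite smn (dist_xx connT); lia.
  have fin : finite_set (s @^-1` (range s `\` range r)).
    by apply: finite_preimage => // ? ? _ _; exact: inj_s.
  exists (\max_(n <- fset_set (s @^-1` (range s `\` range r))) n).+1%N => n.
  rewrite ltnNge => nmax; apply: contrapT => nl; case/negP: nmax.
  apply: (@leq_bigmax_seq _ _ xpredT (fun n => n)) => //.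
  rewrite in_fset_set //; apply/mem_set; split; first by exists n.
  by move=> [l _ lr]; apply: nl; exists l.
have [l0 sl0] := sK K (leqnn K).
(* Running backward from [r l0], at most [l0] steps are possible. *)
have aligned n : (K + l0 < n)%N -> s n = r (l0 + (n - K))%N.
  move=> Kn; have [l sl] := sK n ltac:(lia).
  rewrite sl; congr r.
  have := @rays K n ltac:(lia); rewrite sl0 sl.
  have [/rayr->|ll0] := leqP l0 l; first lia.
  rewrite (dist_sym connT) rayr; lia.
have hs j : height (s j) = K%:Z - l0%:Z - j%:Z.
  have [N hN] := heightP (s j).
  have := hN (l0 + (K + l0 + N + j).+1 - K)%N ltac:(lia).
  have := aligned (K + l0 + N + j).+1 ltac:(lia).
  rewrite addnBA; last lia.
  by move=> <-; rewrite rays; lia.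
by rewrite !hs; lia.
Qed.

Let w := [set s | geodesic_ray s /\ ray_equiv r s].

(** The ancestor lines of [x] and [y] are rays of the end.  The heights at their
    meeting points tie the two indices together, so that minimizing one of them
    minimizes the other. *)
Lemma confluent_exists x y : exists c, is_confluent w x y c.
Proof.
have meet : exists k, `[< exists l, iter k parent x = iter l parent y >].
  have [k [n kn]] := iter_parent_meets x.
  have [l [m lm]] := iter_parent_meets y.
  exists (m + k)%N; apply/asboolP; exists (n + l)%N.
  by rewrite !iterD kn lm !iter_parent_ray addnC.
case: (ex_minnP meet) => k /asboolP[l kl] kmin.
exists (iter k parent x), (fun k => iter k parent x), (fun k => iter k parent y).
have inw z : w (fun k => iter k parent z).
  by split; [exact: geodesic_iter_parent|exact: ray_equiv_iter_parent].
split => //; exists k, l; split => // k' l' kl'.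
have kk' : (k <= k')%N by apply: kmin; apply/asboolP; exists l'.
split => //.
have := congr1 height kl; have := congr1 height kl'.
rewrite !height_iter_parent; lia.
Qed.

(** Along the rays of the end that join [x] and [o] to their confluent, the
    height drops by one at each step, so the two distances are height
    differences. *)
Lemma busemann_height o x : busemann w o x = height x - height o.
Proof.
have [s [t [[rs es] sx [rt et] to [m [n [sm tn _]]]]]] :=
  xgetPex x (confluent_exists x o).
rewrite /busemann -/(confluent w x o) in sm tn *.
have := rs _ _ (leq0n m); have := rt _ _ (leq0n n).
have := height_equiv_ray m rs es; have := height_equiv_ray n rt et.
by rewrite sx to sm tn !subn0 => h1 h2 -> ->; lia.
Qed.

End Ray.
End Tree.

(** * Horocyclic trees *)

(** The structure that an end gives to a regular tree: [pi] is the parent map,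
    [h] the level, and the fibres of [pi] are the sets of children. *)
Record horocyclic (T : lfgraph) (q : nat) (h : T -> int) (pi : T -> T) : Prop :=
  Horocyclic {
    horo_adj : forall x y, adj x y = (y == pi x) || (x == pi y);
    horo_height : forall x, h (pi x) = h x - 1;
    horo_finite : forall x, finite_set [set y | pi y = x];
    horo_card : forall x, #|` fset_set [set y | pi y = x]| = q }.

Lemma homogeneous_tree_horocyclic (T : lfgraph) q o (w : set (nat -> T)) :
  homogeneous_tree q T -> is_end w ->
  exists pi, horocyclic q (busemann w o) pi.
Proof.
move=> [_ connT acycT degT] [r rayr ->].
have heightE x := busemann_height connT acycT rayr o x.
pose pi := parent connT acycT rayr.
have fin x : finite_set [set y | pi y = x].
  apply: sub_finite_set (adj_fin x) => y /= <-.
  by rewrite (adjE connT acycT rayr) eqxx orbT.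
exists pi; split => //.
- exact: adjE.
- by move=> x; rewrite !heightE height_parent addrAC.
- move=> x; have := degT x; rewrite /deg.
  have -> : [set y | adj x y] = pi x |` [set y | pi y = x].
    apply/seteqP; split => y /=; rewrite (adjE connT acycT rayr).
      by case/orP => /eqP ->; [left|right].
    by case=> [->|<-]; rewrite eqxx ?orbT.
  have pix : pi x \notin fset_set [set y | pi y = x].
    rewrite in_fset_set // notin_setE /= => /(congr1 (height connT rayr)).
    by rewrite !height_parent; lia.
  by rewrite fset_setU1 // cardfsU1 pix => -[].
Qed.

Lemma busemann_origin (T : lfgraph) (w : set (nat -> T)) o : busemann w o o = 0.
Proof. exact: subrr. Qed.

Lemma horocyclic_iter (T : lfgraph) q (h : T -> int) pi :
  horocyclic q h pi -> forall k x, h (iter k pi x) = h x - k%:Z.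
Proof.
move=> horoT k x.
by elim: k => [|k IH] /=; rewrite ?(horo_height horoT) ?IH; lia.
Qed.

Lemma horocyclic_fiber_finite (T : lfgraph) q (h : T -> int) pi :
  horocyclic q h pi -> forall k a, finite_set [set x | iter k pi x = a].
Proof.
move=> horoT k; elim: k => [|k IH] a /=; first exact: finite_set1.
apply: (sub_finite_set (B := \bigcup_(z in [set z | pi z = a]) [set x | iter k pi x = z])).
  by move=> x /= <-; exists (iter k pi x).
by apply: bigcup_finite => [|z _]; [exact: horo_finite horoT _|exact: IH].
Qed.

(** * Edge boundaries *)

Definition nbrs (X : lfgraph) (x : X) : {fset X} := fset_set [set y | adj x y].

Lemma in_nbrs (X : lfgraph) (x y : X) : (y \in nbrs x) = adj x y.
Proof.
by rewrite in_fset_set; [apply/idP/idP; rewrite inE|exact: adj_fin].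
Qed.

Lemma card_edge_boundary (X : lfgraph) (F : {fset X}) :
  #|` fset_set (edge_boundary F)| =
  (\sum_(x <- F) count (fun y => y \notin F) (nbrs x))%N.
Proof.
pose t x := [seq y <- nbrs x | y \notin F].
pose s := [seq (x, y) | x <- F, y <- t x].
have memsP e : reflect (edge_boundary F e) (e \in s).
  apply: (iffP allpairsPdep) => [[x [y [xF]]]|[eF eNF xy]].
    by rewrite mem_filter in_nbrs => /andP[yF xy] ->; split.
  exists e.1, e.2; split => //; last by case: (e).
  by rewrite mem_filter in_nbrs eNF.
have fin : finite_set (edge_boundary F).
  apply: (sub_finite_set (B := [set` s])); last exact: finite_seq.
  by move=> e /memsP.
have us : uniq s.
  apply: allpairs_uniq_dep => [||[? ?] [? ?] _ _ /= [-> ->]//].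
    exact: fset_uniq.
  by move=> x _; rewrite filter_uniq ?fset_uniq.
have : perm_eq (fset_set (edge_boundary F)) s.
  apply: uniq_perm; rewrite ?fset_uniq // => e; rewrite in_fset_set //.
  by apply/idP/memsP; rewrite inE.
move=> /perm_size->; rewrite size_allpairs_dep sumnE big_map.
by apply: eq_bigr => x _; rewrite size_filter.
Qed.

Lemma sum_count (S : eqType) (P : pred S) (s : seq S) :
  (\sum_(x <- s) P x)%N = count P s.
Proof. by rewrite -sum1_count [RHS]big_mkcond; apply: eq_bigr => x _; case: (P x). Qed.

Lemma count_leq_fset (X : choiceType) (P : pred X) (A B : {fset X}) :
  (forall x, x \in A -> P x -> x \in B) -> (count P A <= #|` B|)%N.
Proof.
move=> AB; rewrite -size_filter; apply: uniq_leq_size.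
  by rewrite filter_uniq ?fset_uniq.
by move=> x; rewrite mem_filter => /andP[? ?]; exact: AB.
Qed.

(** * Arrows of a Diestel-Leader graph *)

Section DiestelLeaderArrows.
Variables (d : nat) (T : 'I_d -> lfgraph) (q : 'I_d -> nat).
Variables (o : forall i, T i) (w : forall i, set (nat -> T i)).
Variable pi : forall i, T i -> T i.
Arguments w : clear implicits.
Arguments pi : clear implicits.
Hypothesis horoT : forall i, horocyclic (q i) (busemann (w i) (o i)) (pi i).

Local Notation DL := (DL o w).
Implicit Types x y : DL.

Definition level (i : 'I_d) x : int := busemann (w i) (o i) (val x i).

Lemma level_parent i x y : val y i = pi i (val x i) -> level i y = level i x - 1.
Proof. by rewrite /level => ->; exact: horo_height (horoT i) _. Qed.

(** Coordinate [i] moves from [x] to [y] to a child, coordinate [j] to the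
    parent, and the others stay. *)
Definition arrow (i j : 'I_d) (x y : DL) : bool :=
  [&& val x i == pi i (val y i), val y j == pi j (val x j)
    & [forall k, (k != i) && (k != j) ==> (val x k == val y k)]].

Lemma arrowP i j x y : reflect
  [/\ val x i = pi i (val y i), val y j = pi j (val x j)
    & forall k, k != i -> k != j -> val x k = val y k] (arrow i j x y).
Proof.
apply: (iffP and3P) => -[/eqP-> /eqP-> xy]; split => //.
  by move=> k ki kj; apply/eqP; move/forallP/(_ k): xy; rewrite ki kj.
by apply/forallP => k; apply/implyP => /andP[ki kj]; apply/eqP/xy.
Qed.

Lemma arrowC i j x y : arrow i j x y = arrow j i y x.
Proof.
by apply/arrowP/arrowP => -[xi yj xy]; split => // k ? ?; rewrite xy.
Qed.

Lemma sum_level x : \sum_i level i x = 0.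
Proof. exact/eqP/(valP x). Qed.

Lemma level_arrow i j x y : arrow i j x y ->
  level i y = level i x + 1 /\ level j y = level j x - 1.
Proof. by move=> /arrowP[/level_parent-> /level_parent-> _]; rewrite subrK. Qed.

(** Of the four ways to orient the two moving coordinates, those where both go
    up or both go down do not preserve the sum of the levels. *)
Lemma DL_adjE x y :
  adj x y = [exists i, exists j, (i != j) && arrow i j x y].
Proof.
apply/existsP/existsP => -[i /existsP[j]]; last first.
  case/andP => ij /and3P[/eqP xi /eqP yj xy]; exists i; apply/existsP; exists j.
  by rewrite ij xy !(horo_adj (horoT _)) yj xi !eqxx orbT.
case/and4P => ij xyi xyj xy.
have levels : level i x + level j x = level i y + level j y.
  have := sum_level x; have := sum_level y.
  rewrite (bigD1 i) //= (bigD1 j) 1?eq_sym //= addrA => sy.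
  rewrite (bigD1 i) //= (bigD1 j) 1?eq_sym //= addrA.
  rewrite (eq_bigr (fun k => level k y)).
    by move=> sx; exact: (addIr _ (etrans sx (esym sy))).
  by move=> k kij; move/forallP/(_ k): xy; rewrite /level kij /= => /eqP ->.
move: xyi xyj; rewrite !(horo_adj (horoT _)).
case/orP => /eqP xyi; case/orP => /eqP xyj.
- by have := level_parent xyi; have := level_parent xyj; lia.
- exists j; apply/existsP; exists i; rewrite eq_sym ij; apply/arrowP; split => //.
  by move=> k kj ki; apply/eqP; move/forallP/(_ k): xy; rewrite ki kj.
- exists i; apply/existsP; exists j; rewrite ij; apply/arrowP; split => //.
  by move=> k ki kj; apply/eqP; move/forallP/(_ k): xy; rewrite ki kj.
- by have := level_parent xyi; have := level_parent xyj; lia.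
Qed.

(** Taking the arrows among the neighbours gives a finite set, and loses none
    when [i != j], as these arrows are edges. *)
Definition outs (i j : 'I_d) x : {fset DL} := [fset y in nbrs x | arrow i j x y]%fset.

Lemma in_outs i j x y : i != j -> (y \in outs i j x) = arrow i j x y.
Proof.
move=> ij; rewrite !inE in_nbrs andb_idl // => xy.
by rewrite DL_adjE; apply/existsP; exists i; apply/existsP; exists j; rewrite ij.
Qed.

(** The target of an arrow is determined by its coordinate [i], which may be any
    child of that of [x]: the others are the parent in coordinate [j] and those
    of [x]. *)
Lemma card_outs i j x : i != j -> #|` outs i j x| = q i.
Proof.
move=> ij; rewrite -(horo_card (horoT i) (val x i)).
have inj : {in outs i j x &, injective (fun y : DL => val y i)}.
  move=> y y'; rewrite !in_outs // => /arrowP[xi yj xy] /arrowP[_ y'j xy'] yy'.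
  apply/val_inj/functional_extensionality_dep => k.
  have [->//|ki] := eqVneq k i; have [->|kj] := eqVneq k j.
    by rewrite yj y'j.
  by rewrite -xy // xy'.
rewrite -(card_in_imfset imfset_key inj); congr #|` _|.
apply/fsetP => z; rewrite in_fset_set; last exact: horo_finite (horoT i) _.
apply/imfsetP/idP => /= [[y]|].
  by rewrite in_outs // inE => /arrowP[/esym ? _ _] ->.
rewrite inE => piz.
pose f := dfwith (dfwith (val x) (pi j (val x j))) z.
have fi : f i = z by rewrite /f dfwith_in.
have fj : f j = pi j (val x j) by rewrite /f dfwith_out // dfwith_in.
have fk k : k != i -> k != j -> f k = val x k.
  by move=> ki kj; rewrite /f !dfwith_out // eq_sym.
have f0 : \sum_(k < d) busemann (w k) (o k) (f k) == 0.
  have hi : busemann (w i) (o i) z = level i x + 1.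
    by have := horo_height (horoT i) z; rewrite piz /level => ->; rewrite subrK.
  have hj : busemann (w j) (o j) (f j) = level j x - 1.
    by rewrite /level fj (horo_height (horoT j)).
  apply/eqP; rewrite -[RHS](sum_level x).
  rewrite (bigD1 i) //= (bigD1 j) 1?eq_sym //= fi hi hj.
  rewrite [RHS](bigD1 i) //= [X in _ = _ + X](bigD1 j) 1?eq_sym //=.
  rewrite !addrA; congr (_ + _); first lia.
  by apply: eq_bigr => k /andP[ki kj]; rewrite fk.
exists (exist _ f f0 : DL) => //; rewrite in_outs //.
by apply/arrowP; split; rewrite /= ?fi ?fj // => k ki kj; rewrite fk.
Qed.

Lemma count_arrow_out i j x (A : {fset DL}) : i != j ->
  (count (arrow i j x) A <= q i)%N.
Proof.
move=> ij; rewrite -(card_outs x ij); apply: count_leq_fset => y _.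
by rewrite in_outs.
Qed.

Lemma count_arrow_in i j y (A : {fset DL}) : i != j ->
  (count (fun x => arrow i j x y) A <= q j)%N.
Proof.
rewrite eq_sym => ij; under eq_count do rewrite arrowC.
exact: count_arrow_out.
Qed.

(** The vertices [y] of [F] satisfying [Q] receive [q j] arrows each, all emitted
    by vertices [x] of [F] satisfying [P], which emit [q i] arrows each. *)
Lemma arrow_double_count i j (F : {fset DL}) (P Q : pred DL) : i != j ->
  (forall x y, y \in F -> Q y -> arrow i j x y -> (x \in F) && P x) ->
  (q j * count Q F <= q i * count P F)%N.
Proof.
move=> ij QP; have ji : j != i by rewrite eq_sym.
rewrite -!sum_count !big_distrr /=.
apply: (@leq_trans (\sum_(y <- F) \sum_(x <- F) (Q y && P x && arrow i j x y))).
  rewrite big_seq [X in (_ <= X)%N]big_seq; apply: leq_sum => y yF.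
  have [Qy|_] := boolP (Q y); rewrite ?muln0 // muln1 sum_count /=.
  rewrite -(card_outs y ji) -size_filter; apply: uniq_leq_size; first exact: fset_uniq.
  move=> x; rewrite in_outs // -arrowC => xy.
  by rewrite mem_filter xy andbT andbC; exact: QP xy.
rewrite exchange_big /=; apply: leq_sum => x _.
have [Px|_] := boolP (P x); last by rewrite muln0 big1 // => y _; rewrite andbF.
rewrite muln1; apply: leq_trans (count_arrow_out x F ij).
by rewrite -sum_count; apply: leq_sum => y _; rewrite andbT; case: (Q y).
Qed.

(** Split the [q i * #|F|] arrows emitted by [F] according to whether they end
    in [F]. *)
Lemma edge_boundary_arrow i j (F : {fset DL}) : i != j ->
  (q i * #|` F| <= q j * #|` F| + #|` fset_set (edge_boundary F)|)%N.
Proof.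
move=> ij; rewrite card_edge_boundary.
have sum_const n : (\sum_(x <- F) n = n * #|` F|)%N.
  by rewrite big_const_seq count_predT iter_addn_0.
rewrite -!sum_const.
apply: (@leq_trans (\sum_(y <- F) (count (fun x => arrow i j x y) F) +
  \sum_(x <- F) count (fun y => y \notin F) (outs i j x))); last first.
  apply: leq_add; first by apply: leq_sum => y _; exact: count_arrow_in.
  apply: leq_sum => x _; rewrite -!size_filter; apply: uniq_leq_size.
    by rewrite filter_uniq ?fset_uniq.
  by move=> y; rewrite !mem_filter !inE => /andP[-> /andP[->]].
under [X in (_ <= X + _)%N]eq_bigr do rewrite -sum_count.
rewrite exchange_big -big_split /=; apply: leq_sum => x _.
rewrite sum_count -(card_outs x ij) -(count_predC (mem F)) leq_add2r.
rewrite -!size_filter; apply: uniq_leq_size.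
  by rewrite filter_uniq ?fset_uniq.
by move=> y; rewrite !mem_filter in_outs // => /andP[yF ->]; exact: yF.
Qed.

Definition deg_bound : nat := (\sum_i \sum_(j | i != j) q i)%N.

Lemma deg_le x : (deg x <= deg_bound)%N.
Proof.
rewrite /deg -/(nbrs x) /deg_bound.
apply: (@leq_trans (\sum_(y <- nbrs x) \sum_i \sum_(j | i != j) arrow i j x y)).
  rewrite card_fset_sum1 big_seq [X in (_ <= X)%N]big_seq.
  apply: leq_sum => y; rewrite in_nbrs DL_adjE.
  move=> /existsP[i /existsP[j /andP[ij xy]]].
  by rewrite (bigD1 i) //= (bigD1 j) //= xy.
rewrite exchange_big; apply: leq_sum => i _; rewrite exchange_big.
by apply: leq_sum => j ij; rewrite sum_count; exact: count_arrow_out.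
Qed.

Lemma deg_ge i j x : i != j -> (q i <= deg x)%N.
Proof.
move=> ij; rewrite -(card_outs x ij) /deg -/(nbrs x).
by apply: fsubset_leq_card; apply/fsubsetP => y; rewrite !inE => /andP[].
Qed.

(** * Tetrahedra *)

Section Tetrahedron.
Variable m : nat.

Definition apex (i : 'I_d) : T i := iter m (pi i) (o i).

Definition depth (i : 'I_d) x : int := level i x + m%:Z.

Definition tetrahedron_set : set DL :=
  [set x | forall i, exists k, iter k (pi i) (val x i) = apex i].

Lemma depthE i x k : iter k (pi i) (val x i) = apex i -> depth i x = k%:Z.
Proof.
move=> /(congr1 (busemann (w i) (o i))).
rewrite !(horocyclic_iter (horoT i)) busemann_origin /depth /level; lia.
Qed.

Lemma sum_depth x : \sum_i depth i x = (d * m)%:Z.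
Proof.
rewrite big_split /= sum_level add0r sumr_const card_ord.
by rewrite -mulr_natl natz -PoszM.
Qed.

(** Depths are nonnegative with sum [d * m], so each coordinate is one of the
    finitely many descendants of the apex at depth at most [d * m]. *)
Lemma tetrahedron_set_finite : finite_set tetrahedron_set.
Proof.
pose A i : set (T i) := \bigcup_(k in `I_(d * m).+1) [set z | iter k (pi i) z = apex i].
have finA i : finite_set (A i).
  apply: bigcup_finite => [|k _]; first exact: finite_II.
  exact: horocyclic_fiber_finite (horoT i) _ _.
pose B i : {fset T i} := fset_set (A i).
pose g (f : {dffun forall i, B i}) : forall i, T i := fun i => val (f i).
apply: (@sub_finite_set _ _ (val @^-1` range g)); last first.
  apply: finite_preimage; last exact/finite_image/finite_finset.
  by move=> ? ? _ _; exact: val_inj.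
move=> x tx.
have xB i : val x i \in B i.
  rewrite in_fset_set // inE; have [k xk] := tx i; exists k => //=.
  rewrite ltnS -lez_nat -(depthE xk) -(sum_depth x) (bigD1 i) //= lerDl.
  by apply: sumr_ge0 => j _; have [l /depthE ->] := tx j.
exists [ffun k => [` xB k]%fset] => //.
by apply: functional_extensionality_dep => k; rewrite /g ffunE.
Qed.

Definition tetrahedron : {fset DL} := fset_set tetrahedron_set.
Local Notation F := tetrahedron.

Lemma tetrahedronP x :
  reflect (forall i, exists k, iter k (pi i) (val x i) = apex i) (x \in F).
Proof.
by rewrite in_fset_set; [exact: asboolP|exact: tetrahedron_set_finite].
Qed.

Lemma depth_ge0 i x : x \in F -> 0 <= depth i x.
Proof. by move=> /tetrahedronP/(_ i)[k /depthE->]. Qed.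

(** Going backwards along an arrow, coordinate [j] moves to a child and remains
    a descendant, while coordinate [i] moves to its parent, which is a
    descendant as long as it was strictly below the apex. *)
Lemma tetrahedron_arrow i j x y : i != j -> arrow i j x y ->
  y \in F -> 0 < depth i y -> x \in F.
Proof.
move=> ij /arrowP[xi yj xy] /tetrahedronP yF yi; apply/tetrahedronP => k.
have [->|ki] := eqVneq k i.
  have [[|l] yl] := yF i; first by move: yi; rewrite (depthE yl).
  by exists l; rewrite xi -iterSr.
have [->|kj] := eqVneq k j; last by rewrite xy.
by have [l yl] := yF j; exists l.+1; rewrite iterSr -yj.
Qed.

(** The coordinate moving to its parent is the only one that can leave the
    descendants of its apex, and it must start from the apex. *)
Lemma tetrahedron_boundary x y : x \in F -> y \notin F -> adj x y ->
  exists j, depth j x = 0.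
Proof.
move=> xF yF; rewrite DL_adjE => /existsP[i /existsP[j /andP[ij xy]]].
exists j; apply/eqP; rewrite eq_le depth_ge0 // andbT leNgt.
apply: contra yF => xj; rewrite arrowC in xy.
by apply: tetrahedron_arrow xy xF xj; rewrite eq_sym.
Qed.

Definition slice (j : 'I_d) (s : nat) : pred DL := fun x => depth j x == s%:Z.

Definition corner (j i : 'I_d) (s r : nat) : pred DL :=
  fun x => slice j s x && (r%:Z <= depth i x).

Section EqualBranching.
Hypothesis equal_q : forall i j, q i = q j.
Hypothesis q_gt0 : forall i, (0 < q i)%N.

(** One step of the induction reads the arrows of type [(i, j)] backwards: they
    trade one unit of [depth i] for one of [depth j]. *)
Lemma slice_shift i j s r k : i != j ->
  (count (corner j i s (r + k)) F <= count (corner j i (s + k) r) F)%N.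
Proof.
move=> ij; elim: k s => [|k IH] s; first by rewrite !addn0.
apply: (leq_trans _ (leq_trans (IH s.+1) _)); last by rewrite addSnnS.
rewrite -(leq_pmul2l (q_gt0 j)) -[X in (_ <= X * _)%N](equal_q i).
apply: (arrow_double_count ij) => x y yF /andP[/eqP yj yi] xy.
have [hi hj] := level_arrow xy; move: yj yi; rewrite /corner /slice /depth => yj yi.
rewrite (tetrahedron_arrow ij xy yF) /=; last by rewrite /depth; lia.
lia.
Qed.

(** On the face [depth j = 0] the other [d - 1] depths add up to [d * m], so one
    of them is at least [m], hence at least any [s <= m]; shifting the
    corresponding corners gives a bound by the slice at depth [s], and these
    slices are disjoint. *)
Lemma bottom_slice j : (2 <= d)%N ->
  (m.+1 * count (slice j 0) F <= d * #|` F|)%N.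
Proof.
move=> d2.
have slice_le s : (s <= m)%N ->
    (count (slice j 0) F <= d * count (slice j s) F)%N.
  move=> sm.
  apply: (@leq_trans (\sum_(i | i != j)
      count (corner j i 0 s) F)); last first.
    apply: (@leq_trans (\sum_(i < d) count (slice j s) F)).
      rewrite big_mkcond /=; apply: leq_sum => i _; case: ifP => // ij.
      apply: leq_trans (slice_shift 0 0 s ij) _.
      by apply: sub_count => x /andP[].
    by rewrite sum_nat_const card_ord.
  under eq_bigr do rewrite -sum_count.
  rewrite exchange_big -sum_count big_seq [X in (_ <= X)%N]big_seq.
  apply: leq_sum => x xF; rewrite /corner.
  have [/eqP xj|//] := boolP (slice j 0 x); rewrite /=.
  (* Otherwise every other depth is below [m], and their sum below [d * m]. *)
  suff [i ij xi] : exists2 i, i != j & s%:Z <= depth i x.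
    by rewrite (bigD1 i) //= xi.
  apply: contrapT => none.
  have small i : i != j -> depth i x < m%:Z.
    move=> ij; rewrite ltNge; apply/negP => xi; apply: none; exists i => //.
    by rewrite (le_trans _ xi) // lez_nat.
  have [i ij] : exists i, i != j.
    have [j0|j0] := eqVneq (val j) 0%N.
      by exists (Ordinal d2); rewrite -val_eqE j0.
    by exists (Ordinal (ltnW d2)); rewrite -val_eqE /= eq_sym.
  have total : \sum_(k < d) m%:Z = (d * m)%:Z.
    by rewrite sumr_const card_ord -mulr_natl natz -PoszM.
  have : \sum_(k | k != j) depth k x < \sum_(k | k != j) m%:Z.
    by apply: ltr_sum => //; apply/hasP; exists i; rewrite ?mem_index_enum.
  have := sum_depth x; rewrite (bigD1 j) //= xj add0r => ->.
  by rewrite -total [ltLHS](bigD1 j) //= gtrDr ltNge lez_nat.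
apply: (@leq_trans (\sum_(s < m.+1) d * count (slice j s) F)).
  rewrite -[X in (X * _)%N]card_ord -sum_nat_const; apply: leq_sum => s _.
  by apply: slice_le; rewrite -ltnS.
rewrite -big_distrr leq_mul2l /=; apply/orP; right.
under eq_bigr do rewrite -sum_count.
rewrite exchange_big card_fset_sum1; apply: leq_sum => x _.
have [[s xs]|none] := pselect (exists s : 'I_m.+1, depth j x = s%:Z); last first.
  rewrite big1 // => s _; rewrite /slice; case: eqP => // xs; case: none; by exists s.
rewrite (bigD1 s) //= {1}/slice xs eqxx big1 ?addn0 // => s' s's.
by rewrite /slice xs; case: eqP => // -[] /val_inj ss'; rewrite ss' eqxx in s's.
Qed.

Lemma tetrahedron_edge_boundary : (2 <= d)%N ->
  (m.+1 * #|` fset_set (edge_boundary F)| <= deg_bound * d * d * #|` F|)%N.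
Proof.
move=> d2; rewrite card_edge_boundary.
apply: (@leq_trans (m.+1 * (deg_bound * \sum_j count (slice j 0) F))).
  rewrite leq_mul2l /=; under [X in (_ * X)%N]eq_bigr do rewrite -sum_count.
  rewrite exchange_big big_distrr /= big_seq [X in (_ <= X)%N]big_seq.
  apply: leq_sum => x xF.
  have [/hasP[y]|] := boolP (has (fun y => y \notin F) (nbrs (x : DL))); last first.
    by rewrite has_count -eqn0Ngt => /eqP->.
  rewrite in_nbrs => xy yF.
  have [j xj] := tetrahedron_boundary xF yF xy.
  apply: leq_trans (count_size _ _) (leq_trans (deg_le x) _).
  by rewrite (bigD1 j) //= {1}/slice xj eqxx mulnDr muln1 leq_addr.
rewrite mulnCA -!mulnA leq_mul2l; apply/orP; right.
rewrite big_distrr /=; apply: (@leq_trans (\sum_(j < d) d * #|` F|)).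
  by apply: leq_sum => j _; exact: bottom_slice.
by rewrite sum_nat_const card_ord.
Qed.

End EqualBranching.
End Tetrahedron.

Lemma origin_proof : \sum_(i < d) busemann (w i) (o i) (o i) == 0.
Proof. by rewrite big1 // => i _; exact: busemann_origin. Qed.

Definition DL_origin : DL := exist _ (fun i => o i) origin_proof.

Lemma DL_origin_tetrahedron m : DL_origin \in tetrahedron m.
Proof. by apply/tetrahedronP => i; exists m. Qed.

End DiestelLeaderArrows.

(** * Amenability *)

Section IsoperimetricConstant.
Variables (R : realType) (X : lfgraph).
Implicit Type F : {fset X}.

Lemma isoperimetric_constant_ge (x0 : X) (k : R) :
  (forall F, F != fset0 -> k <= #|` fset_set (edge_boundary F)|%:R / (vol F)%:R) ->
  k <= isoperimetric_constant R X.
Proof.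
move=> kF; apply: lb_le_inf; last by move=> _ [F F0 <-]; exact: kF.
exists (#|` fset_set (edge_boundary [fset x0]%fset)|%:R / (vol [fset x0]%fset)%:R).
by exists [fset x0]%fset => //=; apply/fset0Pn; exists x0; rewrite inE.
Qed.

Lemma isoperimetric_constant_le F : F != fset0 ->
  isoperimetric_constant R X <= #|` fset_set (edge_boundary F)|%:R / (vol F)%:R.
Proof.
move=> F0; apply: ge_inf; last by exists F.
by exists 0 => _ [G _ <-]; rewrite divr_ge0.
Qed.

End IsoperimetricConstant.

Theorem mainTheorem2 (R : realType) (d : nat) (q : 'I_d -> nat)
    (T : 'I_d -> lfgraph) (o : forall i, T i)
    (w : forall i, set (nat -> T i)) :
  (2 <= d)%N ->
  (forall i, (2 <= q i)%N) ->
  (forall i, homogeneous_tree (q i) (T i)) ->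
  (forall i, is_end (w i)) ->
  amenable R (DL o w) <-> (forall i j, q i = q j).
Proof.
move=> d2 q2 treeT endw.
have horo i := homogeneous_tree_horocyclic (o i) (treeT i) (endw i).
have [pi horoT] : exists pi : forall i, T i -> T i,
    forall i, horocyclic (q i) (busemann (w i) (o i)) (pi i).
  by exists (fun i => sval (cid (horo i))) => i; case: cid.
have q_gt0 i : (0 < q i)%N by exact: ltnW.
have deg_gt0 (x : DL o w) : (0 < deg x)%N.
  have ne : Ordinal (ltnW d2) != Ordinal d2 by [].
  exact: leq_trans (q_gt0 _) (deg_ge horoT x ne).
have card_vol (F : {fset DL o w}) : (#|` F| <= vol F)%N.
  by rewrite card_fset_sum1; apply: leq_sum.
have card_gt0 (F : {fset DL o w}) : F != fset0 -> (0 < #|` F|)%N.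
  by rewrite cardfs_gt0.
have x0 := DL_origin o w.
split=> [amen|equal_q].
- suff no_larger i j : ~~ (q j < q i)%N.
    by move=> i j; apply/eqP; rewrite eqn_leq leqNgt no_larger /= leqNgt.
  apply/negP => qji.
  have ij : i != j by apply: contraTneq qji => ->; rewrite ltnn.
  have D0 : (0 < deg_bound q)%N.
    exact: leq_trans (deg_gt0 x0) (deg_le horoT x0).
  suff : (deg_bound q)%:R^-1 <= isoperimetric_constant R (DL o w).
    by rewrite amen leNgt invr_gt0 ltr0n D0.
  apply: isoperimetric_constant_ge x0 _ _ => F F0.
  have vol_gt0 : (0 < vol F)%N := leq_trans (card_gt0 F F0) (card_vol F).
  rewrite ler_pdivlMr ?ltr0n // ler_pdivrMl ?ltr0n // -natrM ler_nat.
  apply: (@leq_trans (deg_bound q * #|` F|)).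
    rewrite card_fset_sum1 big_distrr /=; apply: leq_sum => x _.
    by rewrite muln1; exact: deg_le horoT x.
  rewrite leq_mul2l; apply/orP; right.
  have := edge_boundary_arrow horoT F ij; nia.
- apply/eqP; rewrite eq_le; apply/andP; split; last first.
    by apply: isoperimetric_constant_ge x0 _ _ => F _; rewrite divr_ge0.
  rewrite leNgt; apply/negP => iso_gt0.
  set k := isoperimetric_constant R (DL o w) in iso_gt0.
  pose C := (deg_bound q * d * d)%N.
  (* This [m] makes the boundary ratio of the tetrahedron less than [k]. *)
  pose m := Num.truncn (C%:R / k).
  pose F := tetrahedron o w pi m.
  have F0 : F != fset0.
    by apply/fset0Pn; exists (DL_origin o w); exact: DL_origin_tetrahedron.
  have vol_gt0 : (0 < vol F)%N := leq_trans (card_gt0 F F0) (card_vol F).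
  have : (m.+1%:R * k <= C%:R :> R).
    have := isoperimetric_constant_le R F0.
    rewrite -/k ler_pdivlMr ?ltr0n // => kF.
    rewrite -(ler_pM2r (_ : 0 < (vol F)%:R :> R)) ?ltr0n // -mulrA.
    apply: le_trans (ler_wpM2l _ kF) _ => //.
    rewrite -!natrM ler_nat.
    apply: leq_trans (tetrahedron_edge_boundary horoT m equal_q q_gt0 d2) _.
    by rewrite leq_mul2l card_vol orbT.
  rewrite -ler_pdivlMr // leNgt => /negP; apply.
  by apply: truncnS_gt.
Qed.
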